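(* Let $r$ be a non-zero integer, $g$ a non-zero integer, and $E/\mathbb{Q}$ the elliptic curve $y^2=x^3-gx$ (with CM by $\mathbb{Q}(\sqrt{-1})$). Then $\varpi_{E,r}=\varpi_{E,-r}$ if and only if one of the following holds: - $2\nmid r$; - $8\mid r$; - $r\equiv4\ (\mathrm{mod}\ 8)$, $2\mid\lambda$; - $r\equiv2\ (\mathrm{mod}\ 4)$, $2\nmid\lambda$; - $r\equiv2\ (\mathrm{mod}\ 4)$, and $2$ divides both $\lambda$ and $\delta+\frac{\lambda+g_1-1}{2}$.
   Context: Write $g=(-1)^\delta2^\lambda g_1$ with $\delta\in\{0,1\}$, $\lambda\geqslant0$ an integer, $g_1\geqslant1$ odd. Put $\varpi_{E,r}=0$ for $2\nmid r$, and for $2\mid r$ put $\varpi_{E,r}=\frac{h_{1,r}}{4}\kappa$, where $$\kappa=\begin{cases}1-(-1)^{\frac{\lambda r}{4}}\Omega_2+(-1)^{\frac r4(\delta+\frac{g_1-1}{2})}\big(1-(-1)^{\frac{\lambda r}{4}}\big)\Re\big(i^{1+\frac{\lambda r}{4}}\big)\Omega_4,& 4\mid r,\\ 1+\Omega_2+(-1)^{\frac{r-2}{4}+\frac{g_1^2-1}{8}}\big(1-(-1)^{\delta+\frac{\lambda+g_1-1}{2}}\big)\Omega_4,& r\equiv2\ (\mathrm{mod}\ 4),\ 2\mid\lambda,\\ 1,& r\equiv2\ (\mathrm{mod}\ 4),\ 2\nmid\lambda,\end{cases}$$ $\Omega_j=\prod_{p^\nu\parallel g_1,\ p\nmid r,\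 j\nmid\nu}\frac{-1}{p-1-(\frac{-1}{p})}$ (empty product $=1$), and $h_{1,r}=\prod_{p\nmid2r}\big(1-\frac{(\frac{-1}{p})}{p-1}\big)$ (product over primes in increasing order; $(\frac\cdot p)$ the Legendre symbol). *)

(* Defs.v *)
From HB Require Import structures.
From mathcomp Require Import all_boot all_order all_algebra.
From mathcomp Require Import all_classical all_reals all_analysis.
From mathcomp Require Import complex.

Set Implicit Arguments.
Unset Strict Implicit.
Unset Printing Implicit Defensive.

Import Order.TTheory GRing.Theory Num.Theory.
Import numFieldNormedType.Exports.

Local Open Scope ring_scope.
Local Open Scope complex_scope.

(* The Legendre symbol (a / p), for p an odd prime. *)
Definition legendre (a : int) (p : nat) : int :=
  if (p %| a)%Z then 0
  else if [exists x : 'I_p, (p %| (x : nat)%:Z ^+ 2 - a)%Z] then 1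
  else -1.

(* For g != 0 these are the data of the decomposition                        *)
(* g = (-1) ^ delta * 2 ^ lambda * g1 with delta in {0, 1} and g1 odd; see   *)
(* decompE and decomp_uniq.                                                  *)
Definition delta (g : int) : nat := (g < 0)%R.
Definition lambda (g : int) : nat := logn 2 `|g|%N.
Definition g1 (g : int) : nat := partn `|g| 2^'%N.

Lemma decompE (g : int) : g != 0 ->
  [/\ g = (-1) ^+ delta g * 2 ^+ lambda g * (g1 g)%:Z,
      (delta g <= 1)%N, (1 <= g1 g)%N & odd (g1 g)].
Proof.
move=> g0; have ag0 : (0 < `|g|)%N by rewrite absz_gt0.
split; first 2 [by rewrite /delta; case: (g < 0)]; last first.
- by rewrite /g1 odd_2'nat part_pnat.
- exact: part_gt0.
rewrite [LHS]intEsign -mulrA; congr (_ * _).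
by rewrite -[in LHS](partnC 2%N ag0) p_part PoszM -[in RHS]natz -natrX -!natz.
Qed.

Lemma decomp_uniq (g : int) (d l m : nat) :
  (d <= 1)%N -> odd m -> g = (-1) ^+ d * 2 ^+ l * m%:Z ->
  [/\ delta g = d, lambda g = l & g1 g = m].
Proof.
move=> d1 om ->.
have m0 : (0 < m)%N by case: m om.
have -> : (-1) ^+ d * 2 ^+ l * m%:Z = (-1) ^+ d * (2 ^ l * m)%N%:Z :> int.
  by rewrite -mulrA PoszM -[in RHS]natz natrX.
have e : absz ((-1) ^+ d * (2 ^ l * m)%N%:Z) = (2 ^ l * m)%N.
  by rewrite abszM abszX absz_nat /= exp1n mul1n.
have p0 : (0 < 2 ^ l * m)%N by rewrite muln_gt0 expn_gt0 m0.
rewrite /delta /lambda /g1 e; split.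
- case: d d1 {e} => [|[|//]] _.
  + by rewrite expr0 mul1r ltNge lez_nat leq0n.
  + by rewrite expr1 mulN1r oppr_lt0 ltz_nat p0.
- rewrite lognM ?expn_gt0// pfactorK// [logn 2 m]lognE /= dvdn2 om /= andbF.
  by rewrite addn0.
- rewrite partnM ?expn_gt0// part_p'nat ?pnatNK ?pnatX ?pnat_id//.
  by rewrite mul1n part_pnat_id // -odd_2'nat.
Qed.

Section Varpi.
Variable R : realType.

(* Omega_j; p ^ nu exactly divides g1 when nu = logn p g1.                   *)
Definition Omega (g r : int) (j : nat) : R :=
  \prod_(p <- primes (g1 g) | ~~ (p %| r)%Z && ~~ (j %| logn p (g1 g))%N)
    (-1 / (p%:R - 1 - (legendre (-1) p)%:~R)).

(* The infinite product converges only conditionally, so it is the limit of  *)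
(* the products over the primes below N.                                     *)
Definition h1 (r : int) : R :=
  limn (fun N : nat =>
    \prod_(0 <= p < N | prime p && ~~ (p %| 2 * r)%Z)
      (1 - (legendre (-1) p)%:~R / (p%:R - 1)) : R).

(* kappa is meaningful for r even; then all the divisions below are exact.   *)
(* Exponents involving r may be negative.                                    *)
Definition kappa (g r : int) : R :=
  let d := delta g in
  let l := lambda g in
  let m := g1 g in
  if (4 %| r)%Z then
    let s : int := ((l%:Z * r) %/ 4)%Z in
    1 - (-1) ^ s * Omega g r 2
    + (-1) ^ ((r %/ 4)%Z * (d + (m - 1) %/ 2)%N%:Z) * (1 - (-1) ^ s)
      * complex.Re (('i%C : R[i]) ^ (1 + s)) * Omega g r 4
  else if (2 %| l)%N then
    1 + Omega g r 2
    + (-1) ^ (((r - 2) %/ 4)%Z + ((m ^ 2 - 1) %/ 8)%N%:Z)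
      * (1 - (-1) ^+ (d + (l + m - 1) %/ 2)%N) * Omega g r 4
  else 1.

(* The constant varpi_{E,r} of the curve E : y ^ 2 = x ^ 3 - g * x.          *)
Definition varpi (g r : int) : R :=
  if (2 %| r)%Z then h1 r / 4 * kappa g r else 0.

End Varpi.

(* Main.v *)
(* Replacing r by -r changes only the sign of the last term of kappa, so
   everything reduces to the factors of that term, provided that Omega_4 and
   h_{1,r} do not vanish.  For the conditionally convergent product h_{1,r}
   this is Mertens' argument for the character chi modulo 4.  Summing
   chi(n) ln(n) / n over n <= x, which is bounded because the series is
   essentially alternating, and expanding ln n = sum_p v_p(n) ln p gives
   L(1, chi) * sum_(p <= x) chi(p) ln(p) / p + O(1), the error being controlled
   by Chebyshev's bound theta(x) <= x ln 4.  As L(1, chi) >= 2/3, the sum over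
   primes is bounded, and Dirichlet's test makes sum_p chi(p) / (p - 1)
   converge; the product then converges to the exponential of a real number. *)
Require Import Defs.
From mathcomp Require Import all_boot all_order all_algebra.
From mathcomp Require Import all_classical all_reals all_analysis.
From mathcomp Require Import complex zify ring lra.

Import Order.TTheory GRing.Theory Num.Theory.
Import numFieldNormedType.Exports.

Local Open Scope ring_scope.

(** * Chebyshev's upper bound for the product of the primes up to [n] *)

(** The two middle coefficients are equal and both occur in the expansion of (1 + 1) ^ (2m + 1) = 2
    * 4 ^ m. *)
Lemma odd_bin_central_le (m : nat) : ('C(m.*2.+1, m) <= 4 ^ m)%N.
Proof.
have h : ('C(m.*2.+1, m) + 'C(m.*2.+1, m.+1) <= 2 ^ m.*2.+1)%N.
  rewrite -[2%N]/(1 + 1)%N expnDn.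
  have lt1 : (m < m.*2.+2)%N by lia.
  have lt2 : (m.+1 < m.*2.+2)%N by lia.
  rewrite (bigD1 (Ordinal lt1)) //= (bigD1 (Ordinal lt2)) /=; last first.
    by rewrite -val_eqE /=; lia.
  by rewrite !exp1n !muln1 addnA leq_addr.
have e : 'C(m.*2.+1, m.+1) = 'C(m.*2.+1, m).
  by rewrite -bin_sub; [congr binomial; lia | lia].
have : (2 ^ m.*2.+1 = 2 * 4 ^ m)%N by rewrite expnS -mul2n expnM.
lia.
Qed.

Lemma prod_primes_dvd (n : nat) (P : pred nat) (x : nat) :
  (forall p, prime p -> P p -> (p < n)%N -> p %| x)%N ->
  (\prod_(0 <= p < n | prime p && P p) p %| x)%N.
Proof.
elim: n => [|n IH] h; first by rewrite big_geq.
have IHn : (\prod_(0 <= p < n | prime p && P p) p %| x)%N.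
  by apply: IH => p pp Pp ltp; apply: h => //; apply: ltnW.
rewrite big_mkcond big_nat_recr //= -big_mkcond /=.
case: ifP => [/andP[pn Pn]|_]; last by rewrite muln1.
rewrite Gauss_dvd ?IHn ?h //.
rewrite coprime_sym prime_coprime // Euclid_dvd_prod // big_has_cond.
apply/hasPn => q; rewrite mem_index_iota => /andP[_ ltq]; apply/negP.
by case/andP=> /andP[pq _]; rewrite dvdn_prime2 // => /eqP e; lia.
Qed.

(* The primes in (m + 1, 2m + 1] all divide 'C(2m + 1, m) <= 4 ^ m. *)
Lemma primorial_le (n : nat) : (\prod_(0 <= p < n.+1 | prime p) p <= 4 ^ n)%N.
Proof.
elim/ltn_ind: n => n IH.
have [n_le2|n_gt2] := leqP n 2.
  case: n n_le2 {IH} => [|[|[|//]]] _; by rewrite unlock.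
have [on|en] := boolP (odd n); last first.
  rewrite big_mkcond big_nat_recr //= -big_mkcond /= ifF; last first.
    by apply/negP => /even_prime[]; lia.
  rewrite muln1; case: n IH n_gt2 en => // n IH _ _.
  apply: (leq_trans (IH n (ltnSn n))); by rewrite leq_exp2l.
have [m m_def] : exists m, n = m.*2.+1 by exists (n./2); lia.
rewrite (@big_cat_nat _ _ _ m.+2) //=; last by lia.
have -> : (4 ^ n = 4 ^ m.+1 * 4 ^ m)%N by rewrite -expnD; congr (_ ^ _)%N; lia.
apply: leq_mul; first by apply: IH; lia.
apply: leq_trans (odd_bin_central_le m).
apply: dvdn_leq; first by rewrite bin_gt0; lia.
have -> : (\prod_(m.+2 <= p < n.+1 | prime p) p =
  \prod_(0 <= p < n.+1 | prime p && (m.+2 <= p)) p)%N.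
  rewrite [RHS](@big_cat_nat _ _ _ m.+2) //=; last by lia.
  rewrite [X in (_ = X * _)%N]big_nat_cond [X in (_ = X * _)%N]big_pred0 ?mul1n; last first.
    by move=> i; lia.
  rewrite big_nat_cond [RHS]big_nat_cond; apply: eq_bigl => i; lia.
apply: prod_primes_dvd => p pp lep ltp.
have le1 : (m <= m.*2.+1)%N by lia.
have := bin_fact le1.
have -> : (m.*2.+1 - m = m.+1)%N by lia.
move=> e.
have : (p %| (m.*2.+1)`!)%N by rewrite dvdn_fact //; lia.
rewrite -e (Euclid_dvdM _ _ pp) (Euclid_dvdM m`! _ pp).
(* A prime above m + 1 divides neither factorial in the denominator of the binomial coefficient, so
   it divides the coefficient itself. *)
have nf k : (k < p)%N -> (p %| k`!)%N = false.
  move=> ltk; rewrite fact_prod Euclid_dvd_prod // big_has_cond.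
  apply/negbTE/hasPn => q; rewrite mem_index_iota => /andP[q1 ltq]; apply/negP.
  by case/andP=> _ /dvdn_leq; lia.
by rewrite (nf m) ?(nf m.+1) ?orbF //; lia.
Qed.

(** * The nonprincipal character modulo 4 and the quadratic character of -1 *)

Definition chi4 (n : nat) : int :=
  if (n %% 4 == 1)%N then 1 else if (n %% 4 == 3)%N then -1 else 0.

Lemma chi4M (m n : nat) : chi4 (m * n) = chi4 m * chi4 n.
Proof.
rewrite /chi4 -modnMm.
have := ltn_pmod m (isT : 0 < 4)%N; have := ltn_pmod n (isT : 0 < 4)%N.
by case: (m %% 4)%N => [|[|[|[|?]]]]; case: (n %% 4)%N => [|[|[|[|?]]]].
Qed.

Lemma sum_chi4 (n : nat) :
  \sum_(0 <= k < n) chi4 k = ((n %% 4 == 2) || (n %% 4 == 3))%N%:R.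
Proof.
elim: n => [|n IH]; first by rewrite big_geq.
rewrite big_nat_recr //= IH /chi4 -[in RHS]addn1 -modnDml.
have := ltn_pmod n (isT : 0 < 4)%N.
by case: (n %% 4)%N => [|[|[|[|?]]]].
Qed.

(** For p = 4k + 1, some nonzero [a] has a ^ (2k) != 1, and b = a ^ k then satisfies b ^ 4 = 1 and b
    ^ 2 != 1, hence b ^ 2 = -1. For p = 3 modulo 4, y ^ 2 = -1 would give y ^ p = y ^ 3 = - y, while
    Fermat gives y ^ p = y, so y = 0. *)
Lemma legendre_chi4 (p : nat) : prime p -> odd p -> legendre (-1) p = chi4 p.
Proof.
move=> pp op; rewrite /legendre.
have pgt1 := prime_gt1 pp.
have pF := pchar_Fp pp.
rewrite ifF; last by rewrite dvdzE /= dvdn1; apply/negbTE; lia.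
have dvdE (x : nat) : (p %| x%:Z ^+ 2 - (-1))%Z = ((x%:R : 'F_p) ^+ 2 == -1).
  have -> : x%:Z ^+ 2 - (-1) = (x ^ 2 + 1)%N%:Z by lia.
  rewrite dvdzE /= (dvdn_pcharf pF) natrD natrX.
  by rewrite -[RHS]subr_eq0 opprK.
have expp (x : 'F_p) : x ^+ p = x by have := finfield.expf_card x; rewrite card_Fp.
have two0 : (2%:R : 'F_p) != 0.
  by rewrite -(dvdn_pcharf pF); apply/negP => /dvdn_leq; lia.
have p_mod4 : (p %% 4 = 1 \/ p %% 4 = 3)%N by lia.
rewrite /chi4; case: p_mod4 => e; rewrite e /=.
- rewrite ifT //; pose k := (p %/ 4)%N.
  have pE : p = (4 * k).+1 by rewrite /k; lia.
  have k0 : (0 < k)%N by lia.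
  (* Otherwise X ^ (2k) - 1 would have all 4k nonzero residues as roots, more than its degree. *)
  have [a /andP[a0 aN]] : exists a : 'F_p, (a != 0) && (a ^+ (2 * k) != 1).
    apply/existsP; apply: contraT => /existsPn h.
    have sz : size ('X^(2 * k) - 1 : {poly 'F_p}) = (2 * k).+1.
      by rewrite size_XnsubC //; lia.
    have := @max_poly_roots _ ('X^(2 * k) - 1 : {poly 'F_p}) (enum (predC1 0)).
    rewrite sz enum_uniq -cardE cardC1 card_Fp // -size_poly_eq0 sz.
    suff -> : all (root ('X^(2 * k) - 1)) (enum (predC1 (0 : 'F_p))).
      by move=> /(_ isT isT isT); lia.
    apply/allP => a; rewrite mem_enum inE => a0.
    have := h a; rewrite a0 /= negbK => /eqP aE.
    by rewrite rootE !hornerE aE subrr.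
  pose b := a ^+ k.
  have b4 : b ^+ 4 = 1.
    apply: (mulfI a0); rewrite mulr1 -exprM mulnC -exprS -pE; exact: expp.
  have b2 : b ^+ 2 != 1 by rewrite -exprM mulnC.
  have bE : b ^+ 2 == -1.
    have : (b ^+ 2 - 1) * (b ^+ 2 + 1) == 0 by rewrite -subr_sqr_1 -exprM b4 subrr.
    by rewrite mulf_eq0 subr_eq0 (negbTE b2) /= addr_eq0.
  have bp : (val b < p)%N by rewrite -[X in (_ < X)%N](Fp_cast pp) ltn_ord.
  by apply/existsP; exists (Ordinal bp); rewrite dvdE /= natr_Zp.
- rewrite ifF //; apply/negbTE/existsPn => x; rewrite dvdE; apply/negP.
  set y := x%:R; move=> /eqP y2.
  have := expp y; have -> : y ^+ p = y ^+ (3 + 4 * (p %/ 4)).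
    by congr (_ ^+ _); lia.
  have y4 : y ^+ 4 = 1 by rewrite (exprM y 2 2) y2 sqrrN expr1n.
  rewrite exprD exprM y4 expr1n mulr1 exprS y2 mulrN1 => /eqP.
  rewrite eq_sym -subr_eq0 opprK -mulr2n -mulr_natl mulf_eq0 (negbTE two0) /=.
  move=> /eqP y0; move: y2; rewrite y0 expr0n /= => /eqP.
  by rewrite eq_sym oppr_eq0 oner_eq0.
Qed.

(** * Abel summation and Dirichlet's test *)

Section RealField.
Variable R : realType.

(** Summation by parts: the partial sums of [b] get the nonnegative weights a k - a (k + 1) and a
    final weight, and these weights add up to [a m]. *)
Lemma abel_bound (a b : nat -> R) (C : R) (m : nat) :
  (forall n, (m <= n)%N -> a n.+1 <= a n) ->
  (forall n, (m <= n)%N -> 0 <= a n) ->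
  (forall n, `|\sum_(m <= k < n) b k| <= C) ->
  forall n, `|\sum_(m <= k < n) b k * a k| <= C * a m.
Proof.
move=> a_dec a_ge0 b_bnd n.
have C0 : 0 <= C by apply: le_trans (b_bnd 0%N).
have [le_nm|lt_mn] := leqP n m.
  by rewrite big_geq // normr0 mulr_ge0 // a_ge0.
pose B k := \sum_(m <= j < k) b j.
have key j : \sum_(m <= k < m + j) b k * a k =
    B (m + j)%N * a (m + j)%N +
    \sum_(m <= k < m + j) B k.+1 * (a k - a k.+1).
  elim: j => [|j IH]; first by rewrite addn0 /B !big_geq // mul0r addr0.
  rewrite addnS !big_nat_recr ?leq_addr //= IH.
  have -> : B (m + j).+1 = B (m + j)%N + b (m + j)%N.
    by rewrite /B big_nat_recr ?leq_addr.
  ring.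
have -> : n = (m + (n - m))%N by lia.
rewrite key; set j := (n - m)%N.
apply: le_trans (ler_normD _ _) _.
have tele : \sum_(m <= k < m + j) (a k - a k.+1) = a m - a (m + j)%N.
  elim: (j) => [|i IH]; first by rewrite addn0 big_geq // subrr.
  rewrite addnS big_nat_recr ?leq_addr //= IH; ring.
have -> : C * a m = C * a (m + j)%N + \sum_(m <= k < m + j) C * (a k - a k.+1).
  by rewrite -mulr_sumr tele; ring.
apply: lerD.
  rewrite normrM (ger0_norm (a_ge0 _ (leq_addr _ _))).
  by rewrite ler_wpM2r ?b_bnd ?a_ge0 ?leq_addr.
apply: le_trans (ler_norm_sum _ _ _) _.
rewrite big_nat_cond [leRHS]big_nat_cond.
apply: ler_sum => k /andP[/andP[le_mk _] _].
have d0 : 0 <= a k - a k.+1 by rewrite subr_ge0 a_dec.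
by rewrite normrM (ger0_norm d0) ler_wpM2r //; apply: b_bnd.
Qed.

(** Cauchy's criterion, with [abel_bound] applied to each window of the series. As [a] decreases,
    one small value per [e] already says that it tends to 0. *)
Lemma dirichlet_test (a b : nat -> R) (C : R) (m : nat) :
  (forall n, (m <= n)%N -> a n.+1 <= a n) ->
  (forall n, (m <= n)%N -> 0 <= a n) ->
  (forall e, 0 < e -> exists2 n, (m <= n)%N & a n <= e) ->
  (forall n, `|\sum_(0 <= k < n) b k| <= C) ->
  cvgn (series (fun n => b n * a n)).
Proof.
move=> a_dec a_ge0 a_lim b_bnd.
have C0 : 0 <= C by apply: le_trans (b_bnd 0%N).
(* A window is a difference of two partial sums, whence 2 C; the added 1 makes the bound a
   legitimate divisor even when C = 0. *)
have w_bnd k n : `|\sum_(k <= j < n) b j| <= 2 * C + 1.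
  have [le_nk|lt_kn] := leqP n k.
    by rewrite big_geq // normr0; lra.
  have -> : \sum_(k <= j < n) b j =
      \sum_(0 <= j < n) b j - \sum_(0 <= j < k) b j.
    by rewrite (@big_cat_nat _ _ _ k 0 n) ?(ltnW lt_kn) //=; ring.
  apply: le_trans (ler_normB _ _) _.
  have := b_bnd n; have := b_bnd k; lra.
apply/cauchy_cvgP; apply/cauchy_seriesP => e e0.
have [|N le_mN aN] := a_lim (e / (2 * C + 1) / 2).
  by rewrite !divr_gt0 //; lra.
exists ([set n | (N <= n)%N], [set n | (N <= n)%N])%classic.
  by split; exists N.
move=> [i j] /= [Ni Nj].
have ai : a i <= a N.
  rewrite -(subnKC Ni); elim: (i - N)%N => [|k IH]; first by rewrite addn0.
  by rewrite addnS; apply: le_trans IH; apply: a_dec; lia.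
have h : `|\sum_(i <= k < j) b k * a k| <= (2 * C + 1) * a i.
  by apply: abel_bound => // n lein; [apply: a_dec|apply: a_ge0]; lia.
apply: le_lt_trans h _.
have h2 : (2 * C + 1) * a i <= (2 * C + 1) * (e / (2 * C + 1) / 2).
  by apply: ler_wpM2l; [lra | apply: le_trans ai aN].
apply: le_lt_trans h2 _.
have -> : (2 * C + 1) * (e / (2 * C + 1) / 2) = e / 2 by field; lra.
lra.
Qed.

Definition chi (n : nat) : R := (chi4 n)%:~R.

Lemma chiM (m n : nat) : chi (m * n) = chi m * chi n.
Proof. by rewrite /chi chi4M intrM. Qed.

Lemma norm_chi_le1 (n : nat) : `|chi n| <= 1.
Proof.
rewrite /chi /chi4; case: ifP => _; first by rewrite normr1.
by case: ifP => _; rewrite ?mulrN1z ?normrN ?normr1 // normr0.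
Qed.

Lemma sum_chi_le1 (m n : nat) : `|\sum_(m <= k < n) chi k| <= 1.
Proof.
have [le_nm|/ltnW le_mn] := leqP n m; first by rewrite big_geq ?normr0.
have -> : \sum_(m <= k < n) chi k =
    \sum_(0 <= k < n) chi k - \sum_(0 <= k < m) chi k.
  by rewrite (@big_cat_nat _ _ _ m 0 n) //=; ring.
have h j : \sum_(0 <= k < j) chi k = ((j %% 4 == 2) || (j %% 4 == 3))%N%:R.
  by rewrite /chi -rmorph_sum /= sum_chi4 mulrz_nat.
rewrite !h; case: (_ || _); case: (_ || _);
 by rewrite ?subrr ?subr0 ?sub0r ?normrN ?normr1 ?normr0.
Qed.

Lemma bounded_from (f : nat -> R) (C : R) (m : nat) :
  (forall n, `|\sum_(m <= k < n) f k| <= C) ->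
  forall n, `|\sum_(0 <= k < n) f k| <= \sum_(0 <= k < m) `|f k| + C.
Proof.
move=> f_bnd n; have C0 : 0 <= C by apply: le_trans (f_bnd 0%N).
have [le_nm|/ltnW le_mn] := leqP n m.
  apply: le_trans (ler_norm_sum _ _ _) _.
  rewrite (@big_cat_nat _ _ _ n 0 m) //= -addrA lerDl addr_ge0 //.
  exact: sumr_ge0.
rewrite (@big_cat_nat _ _ _ m 0 n) //=.
by apply: le_trans (ler_normD _ _) _; apply: lerD => //; apply: ler_norm_sum.
Qed.

(** * Estimates for logarithms of integers and for sums of ln p *)

Lemma natr_inv_le (m n : nat) : (0 < m)%N -> (m <= n)%N -> n%:R^-1 <= m%:R^-1 :> R.
Proof. by move=> m0 le_mn; rewrite lef_pV2 ?posrE ?ltr0n ?ler_nat //; lia. Qed.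

Lemma ln_nat_ge0 (n : nat) : 0 <= ln n%:R :> R.
Proof. by case: n => [|n]; [rewrite ln0 | rewrite ln_ge0 // ler1n]. Qed.

Lemma ln_prod (I : Type) (s : seq I) (P : pred I) (F : I -> R) :
  (forall i, P i -> 0 < F i) ->
  ln (\prod_(i <- s | P i) F i) = \sum_(i <- s | P i) ln (F i).
Proof.
move=> F0.
suff [] : 0 < \prod_(i <- s | P i) F i /\
  ln (\prod_(i <- s | P i) F i) = \sum_(i <- s | P i) ln (F i) by [].
elim/big_rec2: _ => [|i y x Pi [x0 <-]]; first by rewrite ltr01 ln1.
by rewrite mulr_gt0 ?F0 // lnM // posrE F0.
Qed.

(** The primes run up to a bound [x] independent of [n], so that the sums over [n] and [p] can be
    exchanged in [mertens_chi]. *)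
Lemma ln_nat_logn (n x : nat) : (0 < n <= x)%N ->
  ln n%:R = \sum_(0 <= p < x.+1 | prime p) (logn p n)%:R * ln p%:R :> R.
Proof.
move=> /andP[n0 le_nx].
rewrite -{1}(partnT n0) (widen_partn _ le_nx).
rewrite (eq_bigl predT) // (bigID prime) /= [X in (_ * X)%N]big1 ?muln1.
  rewrite natr_prod ln_prod; last first.
    by move=> p /prime_gt0 p0; rewrite natrX exprn_gt0 // ltr0n.
  apply: eq_bigr => p /prime_gt0 p0.
  by rewrite natrX lnXn ?ltr0n // mulr_natl.
by move=> p pN; rewrite lognE (negbTE pN).
Qed.

Lemma chebyshev_theta (x : nat) :
  \sum_(0 <= p < x.+1 | prime p) ln p%:R <= x%:R * ln 4 :> R.
Proof.
have p0 p : prime p -> 0 < p%:R :> R by move=> /prime_gt0; rewrite ltr0n.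
rewrite -ln_prod // -natr_prod mulr_natl -lnXn // -natrX ler_ln ?posrE.
- by rewrite ler_nat primorial_le.
- by rewrite natr_prod; apply: prodr_gt0 => p /p0.
- by rewrite ltr0n expn_gt0.
Qed.

Lemma ln_succ_le (n : nat) : (0 < n)%N -> ln n.+1%:R <= ln n%:R + n%:R^-1 :> R.
Proof.
move=> n0; have n0' : 0 < n%:R :> R by rewrite ltr0n.
have -> : n.+1%:R = n%:R * (1 + n%:R^-1) :> R.
  by rewrite mulrDr mulr1 divff ?gt_eqF // -natr1.
have i0 : 0 < n%:R^-1 :> R by rewrite invr_gt0.
have i1 : 0 < 1 + n%:R^-1 :> R by lra.
  rewrite lnM ?posrE //.
by rewrite lerD2l le_ln1Dx //; lra.
Qed.

(* The sum telescopes against (ln x + 2) / x. *)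
Lemma sum_ln_div_le2 (n : nat) :
  \sum_(2 <= k < n) ln k%:R / (k%:R * (k%:R - 1)) <= 2 :> R.
Proof.
suff h j : \sum_(2 <= k < j.+2) ln k%:R / (k%:R * (k%:R - 1)) <=
    2 - (ln j.+1%:R + 2) / j.+1%:R :> R.
  case: n => [|[|n]]; [by rewrite big_geq // ler0n|by rewrite big_geq // ler0n|].
  apply: le_trans (h n) _; rewrite gerBl divr_ge0 // addr_ge0 //.
  exact: ln_nat_ge0.
elim: j => [|j IH]; first by rewrite big_geq // ln1; lra.
rewrite big_nat_recr //=; apply: le_trans (lerD IH (lexx _)) _.
have := @ln_succ_le j.+1 isT.
have -> : j.+2%:R = j.+1%:R + 1 :> R by rewrite -natr1.
have x1 : 1 <= j.+1%:R :> R by rewrite ler1n.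
move: x1; move: (j.+1%:R : R) => x x1.
set l := ln (x + 1); set l' := ln x => hl.
have x0 : 0 < x by lra.
rewrite -subr_ge0.
have -> : 2 - (l + 2) / (x + 1) - (2 - (l' + 2) / x + l / ((x + 1) * (x + 1 - 1)))
   = ((l' - l) * (x + 1) + 2) / (x * (x + 1)).
  by field; rewrite !gt_eqF //; lra.
apply: divr_ge0; last by apply: mulr_ge0; lra.
have : (l - l') * (x + 1) <= x^-1 * (x + 1) by apply: ler_wpM2r; lra.
have -> : x^-1 * (x + 1) = 1 + x^-1 by field; rewrite gt_eqF.
have : x^-1 <= 1 by rewrite invf_le1.
lra.
Qed.

Lemma natr_inv_small (e : R) : 0 < e ->
  exists2 n : nat, (1 <= n)%N & n%:R^-1 <= e.
Proof.
move=> e0; exists (Num.truncn e^-1).+1 => //.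
rewrite -[leRHS]invrK lef_pV2 ?posrE ?invr_gt0 ?ltr0n //.
by apply/ltW/truncnS_gt.
Qed.

(** * Partial sums of L(1, chi) and Mertens' argument *)

Definition chi_sum (x : nat) : R := \sum_(0 <= n < x.+1) chi n * n%:R^-1.

Lemma chi0 : chi 0 = 0. Proof. by []. Qed.

Lemma chi_sum_dist (m n : nat) : (0 < m)%N ->
  `|\sum_(m <= k < n) chi k * k%:R^-1| <= m%:R^-1.
Proof.
move=> m0; rewrite -[leRHS]mul1r; apply: abel_bound.
- by move=> k le_mk; apply: natr_inv_le; lia.
- by move=> k _; rewrite invr_ge0.
- by move=> k; apply: sum_chi_le1.
Qed.

Lemma chi_sum_le1 (x : nat) : `|chi_sum x| <= 1.
Proof.
rewrite /chi_sum big_ltn // chi0 mul0r add0r -[leRHS]invr1.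
exact: (@chi_sum_dist 1).
Qed.

(** The number [L] is L(1, chi). Abel summation bounds the tail beyond [x] by 1 / (x + 1); since the
    partial sum at x = 2 is 1, this forces L >= 1 - 1/3. *)
Lemma chi_sum_lim : exists2 L : R, 2 / 3 <= L &
  forall x, `|chi_sum x - L| <= x.+1%:R^-1.
Proof.
pose u n := chi n * n%:R^-1.
have cu : cvgn (series u).
  apply: (@dirichlet_test (fun n => n%:R^-1) chi 1 1).
  - by move=> n n1; apply: natr_inv_le.
  - by move=> n _; rewrite invr_ge0.
  - exact: natr_inv_small.
  - exact: sum_chi_le1.
have dist x n : (x < n)%N -> `|series u n - chi_sum x| <= x.+1%:R^-1.
  move=> lt_xn; rewrite /series /= (@big_cat_nat _ _ _ x.+1 0 n) //=.
  by rewrite addrAC subrr add0r; apply: chi_sum_dist.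
have distL x : `|chi_sum x - limn (series u)| <= x.+1%:R^-1.
  rewrite distrC ler_distl; apply/andP; split.
    apply: limr_ge => //; exists x.+1 => // n /= lt_xn.
    by have := dist x n lt_xn; rewrite ler_distl => /andP[].
  apply: limr_le => //; exists x.+1 => // n /= lt_xn.
  by have := dist x n lt_xn; rewrite ler_distl => /andP[].
exists (limn (series u)) => //.
have := distL 2%N; have -> : chi_sum 2 = 1.
  rewrite /chi_sum !big_nat_recr //= big_geq // /chi /chi4 /=.
  by rewrite mul0r mulr0z mul0r mulr1z invr1 mul1r !add0r addr0.
rewrite ler_distl => /andP[]; lra.
Qed.

Lemma big_multiples (f : nat -> R) (p x : nat) : (0 < p)%N ->
  \sum_(0 <= n < x.+1 | (p %| n)%N) f n = \sum_(0 <= m < (x %/ p).+1) f (p * m)%N.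
Proof.
move=> p0; elim: x => [|x IH].
  by rewrite div0n big_mkcond !big_nat1 dvdn0 muln0.
rewrite big_mkcond big_nat_recr //= -big_mkcond /= IH divnS //.
case: ifP => [p_dvd|_]; last by rewrite addr0 add0n.
rewrite add1n [RHS]big_nat_recr //=; congr (_ + f _).
have := divnS x p0; rewrite p_dvd add1n => <-.
by rewrite mulnC divnK.
Qed.

(* Since v_p(p m) = 1 + v_p(m), this sum satisfies a recursion in x %/ p, which
   bounds it without separating the contributions of the powers of p. *)
Definition chi_val_sum (p x : nat) : R :=
  \sum_(0 <= n < x.+1) chi n * n%:R^-1 * (logn p n)%:R.

Lemma chi_val_sum_rec (p x : nat) : prime p ->
  chi_val_sum p x =
  chi p / p%:R * (chi_sum (x %/ p) + chi_val_sum p (x %/ p)).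
Proof.
move=> pp; have p0 := prime_gt0 pp.
have pR0 : p%:R != 0 :> R by rewrite pnatr_eq0; lia.
rewrite /chi_val_sum (bigID (fun n => p %| n)%N) /= [X in _ + X]big1 ?addr0.
  rewrite big_multiples // /chi_sum -big_split mulr_sumr /=.
  apply: eq_bigr => -[|m] _; first by rewrite muln0 chi0 !mul0r addr0 mulr0.
  rewrite lognM // logn_prime // eqxx chiM natrM natrD.
  have mR0 : m.+1%:R != 0 :> R by rewrite pnatr_eq0.
  rewrite mulr1n; move: m.+1 mR0 => k kR0; field; by rewrite kR0 pR0.
move=> n pN; have [->|n0] := posnP n; first by rewrite chi0 !mul0r.
by rewrite lognE pp n0 (negbTE pN) mulr0.
Qed.

Lemma prime_natr_ge2 (p : nat) : prime p -> 2 <= p%:R :> R.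
Proof. by move=> /prime_gt1; rewrite (ler_nat R 2). Qed.

(** The bound 1 / (p - 1) is the fixed point of t = (1 + t) / p, so the recursion from [x] to
    [x %/ p] preserves it. *)
Lemma chi_val_sum_le (p x : nat) : prime p ->
  `|chi_val_sum p x| <= (p%:R - 1)^-1.
Proof.
move=> pp; have p2 := prime_natr_ge2 _ pp.
elim/ltn_ind: x => x IH.
have [->|x0] := posnP x.
  by rewrite /chi_val_sum big_nat1 chi0 !mul0r normr0 invr_ge0; lra.
rewrite chi_val_sum_rec // !normrM normfV normr_nat.
have -> : (p%:R - 1)^-1 = 1 / p%:R * (1 + (p%:R - 1)^-1) :> R.
  by field; rewrite !gt_eqF //; lra.
have h1 : `|chi p| / p%:R <= 1 / p%:R.
  by apply: ler_wpM2r; [rewrite invr_ge0; lra | apply: norm_chi_le1].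
apply: ler_pM => //.
apply: le_trans (ler_normD _ _) _; apply: lerD; first exact: chi_sum_le1.
by apply: IH; apply: ltn_Pdiv => //; apply: prime_gt1.
Qed.

Lemma ln4_ge1 : 1 <= ln 4 :> R.
Proof.
have h : - 1 < - (1 / 2) :> R by lra.
have := le_ln1Dx h; have -> : 1 + - (1 / 2) = 2^-1 :> R by lra.
have -> : 4 = 2 ^+ 2 :> R by rewrite -natrX.
by rewrite lnV ?posrE // lnXn // -[ln 2 *+ 2]mulr_natl; lra.
Qed.

(** Passing from n to n + 1 increases ln n by at most 1 / n, which is at most (ln n) / n once ln n
    >= 1; the start at 4 lets [ln4_ge1] supply this. *)
Lemma ln_div_dec (n : nat) : (4 <= n)%N ->
  ln n.+1%:R / n.+1%:R <= ln n%:R / n%:R :> R.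
Proof.
move=> n4; have n0 : (0 < n)%N by lia.
have nR : 4 <= n%:R :> R by rewrite (ler_nat R 4).
have h1 : ln 4 <= ln n%:R :> R by rewrite ler_ln ?posrE; lra.
have h2 := ln4_ge1.
have := ln_succ_le n n0; rewrite -natr1.
rewrite ler_pdivrMr; last lra.
move: nR h1; set x := n%:R; set l := ln x; set l' := ln (x + 1) => nR h1 h3.
apply: le_trans h3 _.
have -> : l / x * (x + 1) = l + l / x by field; lra.
by rewrite lerD2l -[leLHS]mul1r; apply: ler_wpM2r; [rewrite invr_ge0|]; lra.
Qed.

Lemma chi_ln_bounded : exists C : R, forall x,
  `|\sum_(0 <= n < x) chi n * (ln n%:R / n%:R)| <= C.
Proof.
eexists; apply: (@bounded_from _ _ 4).
apply: abel_bound (sum_chi_le1 4) => n n4; first exact: ln_div_dec.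
by rewrite divr_ge0 ?ln_nat_ge0.
Qed.

Lemma mertens_chi : exists C : R, forall x,
  `|\sum_(0 <= p < x | prime p) chi p * (ln p%:R / p%:R)| <= C.
Proof.
have [C0 hC0] := chi_ln_bounded.
have [L L0 hL] := chi_sum_lim.
(* The three summands bound, in order, the sum of chi(n) ln(n) / n, the error of replacing
   [chi_sum (x %/ p)] by [L], and the remaining valuation sums. *)
exists ((C0 + ln 4 + 2) / L) => -[|x].
  rewrite big_geq // normr0 divr_ge0 //; last lra.
  have := ln4_ge1; have := le_trans (normr_ge0 _) (hC0 0%N); lra.
pose c p : R := chi p * (ln p%:R / p%:R).
have T_eq : \sum_(0 <= n < x.+1) chi n * (ln n%:R / n%:R) =
   \sum_(0 <= p < x.+1 | prime p) ln p%:R * chi_val_sum p x.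
  under [RHS]eq_bigr do rewrite mulr_sumr.
  rewrite exchange_big /= big_nat_cond [RHS]big_nat_cond.
  apply: eq_bigr => n; rewrite andbT => /andP[_ le_nx].
  have [->|n0] := posnP n.
    by rewrite chi0 mul0r big1 // => p _; rewrite !mul0r mulr0.
  rewrite (ln_nat_logn n x) ?n0 // mulr_suml mulr_sumr.
  by apply: eq_bigr => p _; ring.
have split_eq : L * \sum_(0 <= p < x.+1 | prime p) c p =
   \sum_(0 <= n < x.+1) chi n * (ln n%:R / n%:R)
   - (\sum_(0 <= p < x.+1 | prime p) c p * (chi_sum (x %/ p) - L)
   + \sum_(0 <= p < x.+1 | prime p) c p * chi_val_sum p (x %/ p)).
  rewrite T_eq -big_split /= mulr_sumr -sumrB; apply: eq_bigr => p pp.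
  by rewrite chi_val_sum_rec // /c; ring.
have nc p : `|c p| <= ln p%:R / p%:R.
  have h : 0 <= ln p%:R / p%:R :> R by rewrite divr_ge0 ?ln_nat_ge0.
  rewrite normrM (ger0_norm h) -[leRHS]mul1r.
  by apply: ler_wpM2r => //; apply: norm_chi_le1.
(* Since p * (x %/ p + 1) >= x + 1, each term is at most ln p / (x + 1), and Chebyshev's bound
   applies to the sum of ln p. *)
have bnd1 : `|\sum_(0 <= p < x.+1 | prime p) c p * (chi_sum (x %/ p) - L)|
    <= ln 4.
  have x0 : 0 < x.+1%:R :> R by [].
  have : (\sum_(0 <= p < x.+1 | prime p) ln p%:R) / x.+1%:R <= ln 4 :> R.
    rewrite ler_pdivrMr //; apply: le_trans (chebyshev_theta _) _.
    rewrite mulrC; apply: ler_wpM2l; last by rewrite ler_nat.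
    by have := ln4_ge1; lra.
  apply: le_trans; apply: le_trans (ler_norm_sum _ _ _) _.
  rewrite mulr_suml; apply: ler_sum => p pp.
  have p2 := prime_natr_ge2 _ pp.
  rewrite normrM.
  have h : `|c p| * `|chi_sum (x %/ p) - L| <=
      ln p%:R / p%:R * (x %/ p).+1%:R^-1.
    by apply: ler_pM.
  apply: le_trans h _; rewrite -mulrA; apply: ler_wpM2l.
    exact: ln_nat_ge0.
  rewrite -invfM -natrM; apply: natr_inv_le => //.
  by rewrite mulnC ltn_ceil // prime_gt0.
(* Each term is at most ln p / (p (p - 1)), and the sum is enlarged to all integers from 2 on. The
   upper end [x.+3] keeps the split at 2 valid for small [x]. *)
have bnd2 : `|\sum_(0 <= p < x.+1 | prime p) c p * chi_val_sum p (x %/ p)|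
    <= 2.
  apply: le_trans (ler_norm_sum _ _ _) _.
  apply: le_trans (sum_ln_div_le2 (x.+3)).
  have t0 k : (1 < k)%N -> 0 <= ln k%:R / (k%:R * (k%:R - 1)) :> R.
    move=> k1; have : 2 <= k%:R :> R by rewrite (ler_nat R 2).
    by move=> k2; apply: divr_ge0; [apply: ln_nat_ge0 | apply: mulr_ge0; lra].
  apply: (@le_trans _ _
    (\sum_(0 <= p < x.+3 | prime p) ln p%:R / (p%:R * (p%:R - 1)))).
    rewrite [leRHS](@big_cat_nat _ _ _ x.+1) //=; last by lia.
    apply: ler_wpDr.
      by apply: sumr_ge0 => p /prime_gt1; apply: t0.
    apply: ler_sum => p pp; have p2 := prime_natr_ge2 _ pp.
    rewrite normrM invfM mulrA; apply: ler_pM => //.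
    exact: chi_val_sum_le.
  rewrite (@big_cat_nat _ _ _ 2 0) //= big_nat_cond big_pred0 ?add0r; last by case=> [|[|?]].
  rewrite big_mkcond big_nat_cond [leRHS]big_nat_cond.
  by apply: ler_sum => k /andP[/andP[k1 _] _]; case: ifP => // _; apply: t0.
rewrite ler_pdivlMr; last lra.
have -> : `|\sum_(0 <= p < x.+1 | prime p) c p| * L =
  `|L * \sum_(0 <= p < x.+1 | prime p) c p|.
  by rewrite normrM mulrC ger0_norm //; lra.
rewrite split_eq; apply: le_trans (ler_normB _ _) _.
rewrite -addrA; apply: lerD; first exact: hC0.
by apply: le_trans (ler_normD _ _) _; apply: lerD.
Qed.

(** * Convergence of the product for [h1] and its nonvanishing *)

(* chi(p) / (p - 1) is chi(p) ln(p) / p times the weight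
   n / ((n - 1) ln n), which decreases to 0. *)
Lemma dirichlet_weight_dec (n : nat) : (2 <= n)%N ->
  n.+1%:R / (n.+1%:R - 1) / ln n.+1%:R <= n%:R / (n%:R - 1) / ln n%:R :> R.
Proof.
move=> n2; have nR : 2 <= n%:R :> R by rewrite (ler_nat R 2).
have l0 : 0 < ln n%:R :> R by rewrite ln_gt0 // ltr1n.
have l1 : ln n%:R <= ln n.+1%:R :> R by rewrite ler_ln ?posrE ?ltr0n ?ler_nat //; lia.
apply: ler_pM.
- by rewrite divr_ge0 // -natr1; lra.
- by rewrite invr_ge0; lra.
- rewrite -natr1 ler_pdivrMr; last lra.
  rewrite mulrAC ler_pdivlMr; last lra.
  by rewrite -subr_ge0; move: (n%:R : R) => x; nra.
- by rewrite lef_pV2 ?posrE //; lra.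
Qed.

Lemma dirichlet_weight_small (e : R) : 0 < e ->
  exists2 n : nat, (2 <= n)%N & n%:R / (n%:R - 1) / ln n%:R <= e.
Proof.
(* This choice makes ln n >= 2 / e, while n / (n - 1) <= 2. *)
move=> e0; pose n := (Num.truncn (expR (2 / e))).+2; exists n => //.
have nR : 2 <= n%:R :> R by rewrite (ler_nat R 2).
have l2 : 2 / e <= ln n%:R.
  rewrite -[leLHS]expRK ler_ln ?posrE ?expR_gt0 //.
  apply: le_trans (ltW (truncnS_gt _)) _; by rewrite ler_nat.
have l0 : 0 < ln n%:R :> R by apply: lt_le_trans l2; apply: divr_gt0.
rewrite ler_pdivrMr //; apply: (@le_trans _ _ 2).
  by rewrite ler_pdivrMr; lra.
by rewrite mulrC -ler_pdivrMr.
Qed.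

(** Both sides come from ln (1 + x) <= x, taken at x = - u and at x = u / (1 - u), where 1 + x is
    the inverse of 1 - u. *)
Lemma ln1B_bounds (u : R) : u <= 1 / 2 -> 0 <= - u - ln (1 - u) <= 2 * u ^+ 2.
Proof.
move=> u2; apply/andP; split.
  by have := @le_ln1Dx R (- u); rewrite subr_ge0 => h; apply: h; lra.
have v0 : 0 < 1 - u by lra.
have := @le_ln1Dx R (u / (1 - u)).
have -> : 1 + u / (1 - u) = (1 - u)^-1 by field; lra.
rewrite lnV ?posrE // => h.
have : - ln (1 - u) <= u / (1 - u).
  by apply: h; rewrite ltr_pdivlMr //; lra.
have -> : u / (1 - u) = u + u ^+ 2 / (1 - u) by field; lra.
have : u ^+ 2 / (1 - u) <= u ^+ 2 * 2.
  apply: ler_wpM2l; first exact: sqr_ge0.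
  by rewrite invf_ple ?posrE //; lra.
lra.
Qed.

(** Each factor is exp (- u - w) with 0 <= w <= 2 u ^ 2. The series of [w] has nonnegative terms and
    bounded sums, so only that of [u] may converge conditionally. *)
Lemma cvg_prod_1B (u : nat -> R) :
  (forall n, u n <= 1 / 2) -> cvgn (series u) ->
  (exists C, forall n, \sum_(0 <= k < n) u k ^+ 2 <= C) ->
  exists2 l : R, 0 < l &
    ((fun n : nat => \prod_(0 <= k < n) (1 - u k)) @ \oo --> l)%classic.
Proof.
move=> u2 cu [C hC].
pose w n := - u n - ln (1 - u n).
have w_bnd n : 0 <= w n <= 2 * u n ^+ 2 by apply: ln1B_bounds.
have cw : cvgn (series w).
  apply: nondecreasing_is_cvgn.
    apply/nondecreasing_seqP => n; rewrite /series /= big_nat_recr //= lerDl.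
    by have /andP[] := w_bnd n.
  exists (2 * C) => _ [n _ <-]; rewrite /series /=.
  apply: (@le_trans _ _ (2 * \sum_(0 <= k < n) u k ^+ 2)); last first.
    by rewrite ler_wpM2l.
  by rewrite mulr_sumr; apply: ler_sum => k _; have /andP[] := w_bnd k.
exists (expR (- (limn (series u) + limn (series w)))); first exact: expR_gt0.
have -> : (fun n => \prod_(0 <= k < n) (1 - u k)) =
    expR \o (fun n => - (series u n + series w n)).
  apply/funext => n /=; rewrite /series /= -big_split -sumrN expR_sum /=.
  apply: eq_bigr => k _; rewrite /w.
  have -> : - (u k + (- u k - ln (1 - u k))) = ln (1 - u k) by ring.
  by rewrite lnK // posrE; have := u2 k; lra.
apply: continuous_cvg; first exact: continuous_expR.
by apply: cvgN; apply: cvgD.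
Qed.

(** Telescoping, from 1 / (x + 1) ^ 2 <= 1 / x - 1 / (x + 1) with x = k - 2. *)
Lemma sum_inv_sqr_le2 (n : nat) : \sum_(3 <= k < n) (k%:R - 1) ^- 2 <= 1 :> R.
Proof.
suff h j : \sum_(3 <= k < j.+3) (k%:R - 1) ^- 2 <= 1 - j.+1%:R^-1 :> R.
  case: n => [|[|[|n]]]; try by rewrite big_geq.
  by apply: le_trans (h n) _; rewrite gerBl invr_ge0.
elim: j => [|j IH]; first by rewrite big_geq // invr1 subrr.
rewrite big_nat_recr //=; apply: le_trans (lerD IH (lexx _)) _.
have -> : j.+3%:R - 1 = j.+1%:R + 1 :> R by rewrite -[j.+3]addn1 natrD addrK natr1.
have -> : j.+2%:R = j.+1%:R + 1 :> R by rewrite natr1.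
have : 1 <= j.+1%:R :> R by rewrite ler1n.
move: (j.+1%:R : R) => x x1.
rewrite -subr_ge0.
have -> : 1 - (x + 1)^-1 - (1 - x^-1 + (x + 1) ^- 2) = (x * (x + 1) ^+ 2)^-1.
  by field; rewrite !gt_eqF //; lra.
by rewrite invr_ge0 mulr_ge0 ?sqr_ge0 //; lra.
Qed.

Lemma h1_neq0 (r : int) : r != 0 -> h1 R r != 0.
Proof.
move=> r0.
pose P p := prime p && ~~ (p %| 2 * r)%Z.
pose u p : R := if P p then chi p / (p%:R - 1) else 0.
have P_ge3 p : P p -> (3 <= p)%N.
  move=> /andP[pp pN]; have p2 : p != 2 by apply: contraNneq pN => ->; rewrite dvdz_mulr.
  by have := prime_gt1 pp; lia.
have u_bnd p : `|u p| <= if P p then (p%:R - 1)^-1 else 0.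
  rewrite /u; case: ifP => [/P_ge3|]; last by rewrite normr0.
  rewrite -(ler_nat R) => p3; rewrite normrM normfV [X in _ / X]ger0_norm; last lra.
  rewrite -[leRHS]mul1r; apply: ler_wpM2r; last exact: norm_chi_le1.
  by rewrite invr_ge0; lra.
have u_half p : u p <= 1 / 2.
  apply: le_trans (ler_norm _) _; apply: le_trans (u_bnd p) _.
  case: ifP => [/P_ge3|_]; last by lra.
  by rewrite -(ler_nat R) => p3; rewrite mul1r lef_pV2 ?posrE //; lra.
have u_sqr n : \sum_(0 <= k < n) u k ^+ 2 <= 1.
  have nn k : 0 <= u k ^+ 2 by exact: sqr_ge0.
  apply: (@le_trans _ _ (\sum_(0 <= k < n.+3) u k ^+ 2)).
    by rewrite [leRHS](@big_cat_nat _ _ _ n 0) /= ?lerDl ?sumr_ge0 //; lia.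
  have u_small k : (k < 3)%N -> u k = 0.
    by rewrite /u; case: ifP => // /P_ge3; lia.
  rewrite (@big_cat_nat _ _ _ 3 0) //= big_nat big1 ?add0r; last first.
    by move=> k /andP[_ k3]; rewrite u_small // expr0n.
  apply: le_trans (sum_inv_sqr_le2 n.+3).
  rewrite big_nat_cond [leRHS]big_nat_cond.
  apply: ler_sum => k /andP[/andP[k3 _] _].
  have i0 : 0 <= (k%:R - 1)^-1 :> R.
    by move: k3; rewrite -(ler_nat R) invr_ge0; lra.
  rewrite -(real_normK (num_real (u k))) -exprVn ler_pXn2r ?nnegrE //.
  by apply: le_trans (u_bnd k) _; case: ifP.
pose b n : R := if P n then chi n * (ln n%:R / n%:R) else 0.
have [C b_bnd] : exists C, forall n, `|\sum_(0 <= k < n) b k| <= C.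
  have [C hC] := mertens_chi.
  (* Beyond |2r| no prime divides 2r, so there [P] agrees with [prime], and a difference of two sums
     from [mertens_chi] costs 2 C. *)
  eexists; apply: (@bounded_from _ (2 * C) (`|(2 * r)%R|%N.+1)) => n.
  set K := `|_|%N.+1.
  have [le_nK|/ltnW le_Kn] := leqP n K.
    by rewrite big_geq // normr0; have := le_trans (normr_ge0 _) (hC 0%N); lra.
  have -> : \sum_(K <= k < n) b k =
     \sum_(0 <= p < n | prime p) chi p * (ln p%:R / p%:R) -
     \sum_(0 <= p < K | prime p) chi p * (ln p%:R / p%:R).
    rewrite (@big_cat_nat _ _ _ K 0 n) //= addrAC subrr add0r.
    rewrite [RHS]big_mkcond big_nat_cond [RHS]big_nat_cond.
    apply: eq_bigr => k /andP[/andP[le_Kk _] _]; rewrite /b.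
    suff -> : P k = prime k by [].
    rewrite /P; case: (prime k) => //=; rewrite dvdzE /=.
    by apply/negP => /dvdn_leq; move: le_Kk; rewrite /K; lia.
  apply: le_trans (ler_normB _ _) _; have := hC n; have := hC K; lra.
have cu : cvgn (series u).
  have -> : u = fun n => b n * (n%:R / (n%:R - 1) / ln n%:R).
    apply/funext => n; rewrite /u /b; case: ifP => [/P_ge3 n3|]; last by rewrite mul0r.
    have l0 : 0 < ln n%:R :> R by rewrite ln_gt0 // ltr1n; lia.
    have nR : 3 <= n%:R :> R by rewrite (ler_nat R 3).
    by field; rewrite !gt_eqF //; lra.
  apply: dirichlet_test (dirichlet_weight_dec) _ (dirichlet_weight_small) b_bnd.
  move=> n n2; have nR : 2 <= n%:R :> R by rewrite (ler_nat R 2).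
  by apply: divr_ge0; [apply: divr_ge0; lra | apply: ln_nat_ge0].
have [l l0 lim_l] := cvg_prod_1B u u_half cu (ex_intro _ _ u_sqr).
rewrite /h1 (_ : (fun N : nat => _) = (fun n => \prod_(0 <= k < n) (1 - u k))).
  by rewrite (cvg_lim _ lim_l) ?gt_eqF.
apply/funext => n; rewrite big_mkcond; apply: eq_bigr => p _.
rewrite /u /P; case: ifP => [Pp|_]; last by rewrite subr0.
have /andP[pp _] := Pp; rewrite legendre_chi4 //.
have := P_ge3 _ Pp; rewrite leqNgt.
by case: (even_prime pp) => // ->.
Qed.

(** The primes involved divide the odd number [g1 g], so p >= 3 and each denominator is at least 3 -
    1 - 1 = 1. *)
Lemma Omega_neq0 (g r : int) (j : nat) : g != 0 -> Omega R g r j != 0.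
Proof.
move=> g0; rewrite /Omega prodf_seq_neq0; apply/allP => p.
rewrite mem_primes => /and3P[pp m0 p_dvd]; apply/implyP => _.
have [_ _ _ odd_m] := decompE g0.
have op : odd p by apply: dvdn_odd p_dvd odd_m.
have p3 : 3 <= p%:R :> R.
  by rewrite (ler_nat R 3); have := prime_gt1 pp; case: (p) op => [|[|[|?]]].
rewrite legendre_chi4 // mulf_neq0 ?oppr_eq0 ?oner_eq0 // invr_eq0 gt_eqF //.
by have := norm_chi_le1 p; rewrite ler_norml => /andP[_]; rewrite /chi; lra.
Qed.

(** * Effect of replacing [r] by [- r] *)

Lemma dvdzNr (d m : int) : (d %| - m)%Z = (d %| m)%Z.
Proof. by rewrite !dvdzE abszN. Qed.

Lemma h1N (r : int) : h1 R (- r) = h1 R r.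
Proof.
congr (limn _); apply/funext => N; apply: eq_bigl => p.
by rewrite mulrN dvdzNr.
Qed.

Lemma OmegaN (g r : int) (j : nat) : Omega R g (- r) j = Omega R g r j.
Proof. by apply: eq_bigl => p; rewrite dvdzNr. Qed.

Lemma varpiN_eq (g r : int) : r != 0 -> (2 %| r)%Z ->
  varpi R g r = varpi R g (- r) <-> kappa R g r = kappa R g (- r).
Proof.
move=> r0 r2; rewrite /varpi dvdzNr r2 h1N; split=> [|->] //.
by apply/mulfI/mulf_neq0; [apply: h1_neq0 | rewrite invr_eq0].
Qed.

Lemma signzE (z : int) : (-1) ^ z = (-1) ^+ odd `|z|%N :> R.
Proof. by rewrite expN1r signr_odd. Qed.

Lemma signzN (z : int) : (-1) ^ (- z) = (-1) ^ z :> R.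
Proof. by rewrite !signzE abszN. Qed.

Lemma Re_i_even (t : int) : complex.Re (('i%C : R[i]) ^ (2 * t)) = (-1) ^ t.
Proof.
rewrite -exprz_exp -exprnP sqr_i expN1r signzE -signr_odd.
by case: (odd _).
Qed.

(** With s = lambda * k, an even [s] kills the last term through 1 - (-1) ^ s. For s = 2t + 1 the
    exponents 1 + s and 1 - s are 2 (t + 1) and - 2t, so the two real parts are opposite and
    nonzero, while the other factors agree. *)
Lemma kappaN_4 (g k : int) : g != 0 ->
  kappa R g (4 * k) = kappa R g (- (4 * k)) <->
  ~~ odd `|((lambda g)%:Z * k)%R|%N.
Proof.
move=> g0; rewrite /kappa dvdzNr dvdz_mulr //.
have -> : ((lambda g)%:Z * (4 * k) %/ 4)%Z = (lambda g)%:Z * k.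
  by rewrite mulrCA mulKz.
have -> : ((lambda g)%:Z * - (4 * k) %/ 4)%Z = - ((lambda g)%:Z * k).
  by rewrite mulrN mulrCA -mulrN mulKz.
have -> : (4 * k %/ 4)%Z = k by lia.
have -> : (- (4 * k) %/ 4)%Z = - k by lia.
set s := _ * k; set D := (delta g + _)%N%:Z.
rewrite !OmegaN mulNr !signzN.
have [s_even|s_odd] := boolP (~~ odd `|s|%N).
  by rewrite !(signzE s) (negbTE s_even) expr0 subrr mulr0 !mul0r.
split=> //; move: s_odd; rewrite negbK => s_odd.
have [t s_def] : exists t, s = 2 * t + 1 by exists (s %/ 2)%Z; lia.
have -> : 1 + s = 2 * (t + 1) by rewrite s_def; ring.
have -> : 1 - s = 2 * (- t) by rewrite s_def; ring.
rewrite !Re_i_even signzN.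
have -> : (-1) ^ (t + 1) = - (-1) ^ t :> R.
  by rewrite expfzDr ?oppr_eq0 ?oner_eq0 // expr1z mulrN1.
rewrite (signzE s) s_odd expr1 => /addrI /(mulIf (Omega_neq0 _ _ _ g0)) /mulfI e.
have : - (-1) ^ t = (-1) ^ t :> R.
  by apply: e; rewrite mulf_neq0 ?signzE ?signr_eq0 // opprK -mulr2n pnatr_eq0.
by rewrite signzE; case: (odd _); rewrite ?expr0 ?expr1; lra.
Qed.

(** For even [lambda g], the exponents (r - 2) / 4 for [r] and [- r] are k and - (k + 1), of
    opposite parity. The last term thus changes sign, and equality means that its factor 1 - (-1) ^
    e vanishes. *)
Lemma kappaN_2 (g k : int) : g != 0 ->
  kappa R g (4 * k + 2) = kappa R g (- (4 * k + 2)) <->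
  (2 %| lambda g)%N ==> (2 %| delta g + (lambda g + g1 g - 1) %/ 2)%N.
Proof.
move=> g0; rewrite /kappa dvdzNr.
have -> : (4 %| 4 * k + 2)%Z = false by lia.
case: ifP => //= _; rewrite !OmegaN.
have -> : ((4 * k + 2 - 2) %/ 4)%Z = k by lia.
have -> : ((- (4 * k + 2) - 2) %/ 4)%Z = - (k + 1) by lia.
set m := (_ %/ 8)%N; set e := (delta g + _)%N.
have N1 : -1 != 0 :> R by rewrite oppr_eq0 oner_eq0.
rewrite !(expfzDr _ _ N1) signzN (expfzDr _ _ N1) expr1z mulrN1 !mulNr.
rewrite -(signr_odd _ e) dvdn2.
case: (odd e); rewrite /= ?expr0 ?expr1; last by rewrite subrr !mulr0 !mul0r subr0 addr0; split.
split=> // /addrI/eqP; rewrite -addr_eq0 -mulr2n mulrn_eq0 /=.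
rewrite !mulf_eq0 (negbTE (Omega_neq0 _ _ _ g0)) !expfz_eq0 (negbTE N1) !andbF /=.
by rewrite opprK -mulr2n pnatr_eq0.
Qed.

End RealField.

Theorem theorem7p11 (R : realType) (r g : int) (r_neq0 : r != 0)
    (g_neq0 : g != 0) :
  varpi R g r = varpi R g (- r) <->
    ~ (2 %| r)%Z
    \/ (8 %| r)%Z
    \/ ((r = 4 %[mod 8])%Z /\ (2 %| lambda g)%N)
    \/ ((r = 2 %[mod 4])%Z /\ ~ (2 %| lambda g)%N)
    \/ ((r = 2 %[mod 4])%Z /\
        ((2 %| lambda g)%N /\ (2 %| delta g + (lambda g + g1 g - 1) %/ 2)%N)).
Proof.
have [r2|r2] := boolP (2 %| r)%Z; last first.
  by rewrite /varpi dvdzNr (negbTE r2); split=> // _; left.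
rewrite (varpiN_eq R g r r_neq0 r2).
have [k [r_def|r_def]] : exists k, r = 4 * k \/ r = 4 * k + 2.
  by exists (r %/ 4)%Z; lia.
(* Here [8 %| r] says that [k] is even; when [k] is odd, r = 4 modulo 8 and lambda * k has the
   parity of lambda. *)
- rewrite {1 2}r_def (kappaN_4 R g k g_neq0) abszM oddM /=; lia.
- rewrite {1 2}r_def (kappaN_2 R g k g_neq0); split.
    case: (boolP (2 %| lambda g)%N) => /= h h'; last by do 3 right; left; split; lia.
    by do 4 right; split; first lia.
  case: (boolP (2 %| lambda g)%N) => //= h [|[|[|[]]]]; lia.
Qed.
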